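(* Let $\operatorname{Spec}(\mathbb N)$ denote the set of real numbers $\beta$ for which there exist positive integers $m_i\to\infty$ and integers $r_i$ with $\gcd(r_i,m_i)=1$ such that $H(r_i/m_i)\to\beta$. Then \[\operatorname{Spec}(\mathbb N)=\{0\}\cup\{1/k : k\in\mathbb Z^+\}.\]
   Context: For relatively prime positive integers $r,m$, define \[H(r/m)=\min\{\,k/m+\{kr/m\} : 1\le k<m\,\},\] where $\{x\}=x-\lfloor x\rfloor$ is the fractional part of $x$. Equivalently $H(r/m)=m^{-1}\min\{k+(kr \bmod m):1\le k<m\}$, where $x\bmod m$ is the least nonnegative residue of $x$ modulo $m$; this is $m^{-1}$ times the height of the point $\langle 1,r\rangle\in(\mathbb Z_m^\ast)^2$. *)

(* Defs.v *)
From HB Require Import structures.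
From mathcomp Require Import all_boot all_order all_algebra.
From mathcomp Require Import all_classical all_reals all_analysis.

Set Implicit Arguments.
Unset Strict Implicit.
Unset Printing Implicit Defensive.

Import Order.TTheory GRing.Theory Num.Theory.
Import numFieldNormedType.Exports.

Local Open Scope classical_set_scope.
Local Open Scope ring_scope.

Definition frac (R : realType) (x : R) : R := x - (Num.floor x)%:~R.

Definition height_term (R : realType) (r : int) (m k : nat) : R :=
  k%:R / m%:R + frac (k%:R * r%:~R / m%:R).

(* H(r/m), with numerator and denominator passed separately. The default value
   of the iterated minimum is the term k = 1, which lies in the range as soon
   as 1 < m, so H is then a genuine minimum (lemma HP). For m <= 1 the range is
   empty and the value carries no meaning. *)
Definition H (R : realType) (r : int) (m : nat) : R :=
  \big[Num.min/height_term R r m 1]_(1 <= k < m) height_term R r m k.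

Lemma HP (R : realType) (r : int) (m : nat) : (1 < m)%N ->
  (exists2 k, (1 <= k < m)%N & H R r m = height_term R r m k) /\
  (forall k, (1 <= k < m)%N -> H R r m <= height_term R r m k).
Proof.
move=> m_gt1; split=> [|k hk]; last first.
  by apply: ge_bigmin_seq => //; rewrite mem_index_iota.
rewrite /H big_seq.
elim/big_ind: _ => [|x y [k hk ->] [l hl ->]|k].
- by exists 1%N.
- by case: leP => _; [exists k | exists l].
- by rewrite mem_index_iota => hk; exists k.
Qed.

Definition Spec (R : realType) : set R :=
  [set beta | exists (m : nat -> nat) (r : nat -> int),
    [/\ forall i, (0 < m i)%N,
        m @ \oo --> \oo,
        forall i, coprimez (r i) (m i)%:Z &
        H R (r i) (m i) @[i --> \oo] --> beta]].

Arguments Spec : clear implicits.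

(* Main.v *)
Require Import Defs.
From mathcomp Require Import all_boot all_order all_algebra.
From mathcomp Require Import all_classical all_reals all_analysis.
From mathcomp Require Import zify ring lra.

Import Order.TTheory GRing.Theory Num.Theory.
Import numFieldNormedType.Exports.

(* Points (k, kr mod m) are the points of the positive quadrant in the lattice
   L = {(x, y) : y = x r mod m} of index m. By Thue's lemma L has a nonzero
   vector with coordinates at most sqrt m. If it can be taken in the quadrant,
   then H is O(1 / sqrt m). Otherwise it can be taken of the form (a, -b) with
   a, b > 0 and primitive in L, so that L lies on the lines b x + a y = j m with
   j integral. Points of the quadrant have j >= 1, so H >= 1 / max(a, b), and a
   point of the line j = 1 close to an axis shows that H <= 1 / max(a, b) +
   O(1 / sqrt m). Hence H is always close to {0} U {1/k}, which is closed.
   Conversely 0 is the limit for r = 1, and 1/k is the limit for r = - k and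
   m = k n + 1. *)

Local Open Scope classical_set_scope.
Local Open Scope ring_scope.

(** * Integer form of the heights, and bounds on [H] from lattice points *)

Lemma height_termE (R : realType) (r : int) (m k : nat) : (0 < m)%N ->
  height_term R r m k = (k%:Z + ((k%:Z * r) %% m)%Z)%:~R / m%:R.
Proof.
move=> m_gt0; have mR : 0 < m%:R :> R by rewrite ltr0n.
have e : k%:R * r%:~R = ((k%:Z * r) %/ m)%Z%:~R * m%:R
    + ((k%:Z * r) %% m)%Z%:~R :> R.
  by rewrite -[m%:R]/(m%:Z%:~R) -intrM -intrD -divz_eq intrM.
have t0 : 0 <= ((k%:Z * r) %% m)%Z%:~R :> R by rewrite ler0z modz_ge0 //; lia.
have t1 : ((k%:Z * r) %% m)%Z%:~R < m%:R :> R.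
  by rewrite -[m%:R]/(m%:Z%:~R) ltr_int ltz_pmod //; lia.
have ed : k%:R * r%:~R / m%:R = ((k%:Z * r) %/ m)%Z%:~R
    + ((k%:Z * r) %% m)%Z%:~R / m%:R :> R.
  by rewrite e mulrDl mulfK // gt_eqF.
have fl : Num.floor (k%:R * r%:~R / m%:R : R) = ((k%:Z * r) %/ m)%Z.
  apply: floor_def; rewrite ed intrD lerDl divr_ge0 ?(ltW mR) //= ltrD2l.
  by rewrite ltr_pdivrMr // mul1r.
by rewrite /height_term /Defs.frac fl ed [_ + _ / _]addrC addrK intrD mulrDl.
Qed.

(** A value y >= m is allowed, since the residue of x r is then smaller still. *)
Lemma H_le (R : realType) (r : int) (m : nat) (x y q : int) :
  0 < x < m%:Z -> 0 <= y -> y = x * r - q * m ->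
  H R r m <= (x + y)%:~R / m%:R.
Proof.
case: x => [k|k] // /andP[k0 km] y0 yE.
have m1 : (1 < m)%N by lia.
have hk : (1 <= k < m)%N by lia.
apply: (le_trans ((HP R r m1).2 k hk)).
rewrite height_termE ?(ltnW m1) // ler_pM2r ?invr_gt0 ?ltr0n ?(ltnW m1) //.
rewrite ler_int lerD2l.
have -> : k%:Z * r = q * m + y by lia.
rewrite modzMDl; case: (ltP y m) => ym; first by rewrite modz_small ?y0.
by apply: le_trans ym; apply/ltW/ltz_pmod; lia.
Qed.

Lemma H_attained (R : realType) (r : int) (m : nat) : (1 < m)%N ->
  exists x y q : int, [/\ 0 < x < m%:Z, 0 <= y, y = x * r - q * m
    & H R r m = (x + y)%:~R / m%:R].
Proof.
move=> m1; have [k /andP[k0 km] ->] := (HP R r m1).1.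
exists k%:Z, ((k%:Z * r) %% m)%Z, ((k%:Z * r) %/ m)%Z.
split; [lia | by apply: modz_ge0; lia | | by apply: height_termE; lia].
by have := divz_eq (k%:Z * r) m; lia.
Qed.

(** At a point (x, y) attaining [H], b x + a y is a positive multiple of m, hence at least m, while
    it is at most c (x + y). *)
Lemma H_ge (R : realType) (r : int) (m : nat) (a b c q : int) : (1 < m)%N ->
  0 < a <= c -> 0 < b <= c -> a * r + b = q * m -> c%:~R^-1 <= H R r m.
Proof.
move=> m1 /andP[a0 ac] /andP[b0 bc] vE.
have [x [y [p [/andP[x0 xm] y0 yE ->]]]] := H_attained R r m m1.
rewrite ler_pdivlMr ?ltr0n ?(ltnW m1) // mulrC.
rewrite ler_pdivrMr; last by rewrite ltr0z; lia.
rewrite -intrM -[m%:R]/(m%:Z%:~R) ler_int.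
have e : b * x + a * y = (q * x - a * p) * m.
  rewrite yE; have -> : b = q * m - a * r by lia.
  ring.
have bx : 0 < b * x by rewrite mulr_gt0.
have ay : 0 <= a * y by rewrite mulr_ge0 // ltW.
have j0 : 0 < q * x - a * p by nia.
have : b * x <= c * x by rewrite ler_pM2r.
have : a * y <= c * y by rewrite ler_wpM2r.
nia.
Qed.

(** * Short lattice vectors and the approximation of [H] *)

Lemma thue (r : int) (m s : nat) : (s < m)%N -> (m < s.+1 ^ 2)%N ->
  exists a e q : int, [/\ 0 < a <= s%:Z, - s%:Z <= e <= s%:Z
    & a * r - e = q * m].
Proof.
case: m => // m sm ms.
pose f (u : 'I_s.+1 * 'I_s.+1) : 'I_m.+1 :=
  inord `|((u.1%:Z * r - u.2%:Z) %% m.+1)%Z|%N.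
(* Pigeonhole: there are (s + 1)^2 > m pairs and only m residues. *)
have /injectivePn [u [v]] : ~~ injectiveb f.
  by apply/injectiveP => /leq_card; rewrite card_prod !card_ord; lia.
wlog lt : u v / (v.1 <= u.1)%N.
  move=> W uv fuv; case/orP: (leq_total v.1 u.1) => h; first exact: (W u v).
  by apply: (W v u) => //; rewrite eq_sym.
move=> uv fuv.
have : ((u.1%:Z * r - u.2%:Z) = (v.1%:Z * r - v.2%:Z) %[mod m.+1])%Z.
  have := congr1 (@nat_of_ord m.+1) fuv.
  have b (z : int) : 0 <= (z %% m.+1)%Z < m.+1%:Z.
    by rewrite modz_ge0 //= ltz_pmod.
  have := b (u.1%:Z * r - u.2%:Z); have := b (v.1%:Z * r - v.2%:Z).
  rewrite /f; move=> b1 b2; rewrite !inordK; lia.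
move=> /eqP; rewrite eqz_mod_dvd => /dvdzP [q qE].
have := ltn_ord u.1; have := ltn_ord u.2.
have := ltn_ord v.1; have := ltn_ord v.2.
move=> v2 v1 u2 u1.
exists (u.1%:Z - v.1%:Z), (u.2%:Z - v.2%:Z), q; split; [|lia|lia].
(* If the first coordinates agreed, m would divide a difference of size at most s < m, and the two
   pairs would coincide. *)
suff : (u.1 : nat) <> v.1 by lia.
move=> e1.
have q0 : q = 0 by move: qE; rewrite e1; nia.
case/eqP: uv; case: u v {lt fuv} e1 qE u1 u2 v1 v2 => [u1 u2] [v1 v2] /= e1.
rewrite q0 e1 => qE _ _ _ _; congr pair; apply: val_inj => //=.
lia.
Qed.

(* The lattice points with [b x + a y = m] form a translate of the multiples of
   (a, -b); the one chosen lies at the end of the segment where x + y is least,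
   that is near (m/b, 0) if [a <= b] and near (0, m/a) otherwise. *)
Lemma near_point (r : int) (m s : nat) (a b q u v : int) :
  (s < m)%N -> (s ^ 2 <= m)%N ->
  0 < a <= s%:Z -> 0 < b <= s%:Z ->
  a * r + b = q * m -> u * q + v * a = 1 ->
  exists x y p : int, [/\ 0 < x < m%:Z, 0 <= y, y = x * r - p * m
    & Num.max a b * (x + y) <= m%:Z + Num.max a b * s].
Proof.
move=> sm s2 /andP[a0 As] /andP[b0 bs] vE bez.
(* Bezout gives the point t = 0 of the line j = 1; the others differ from it by t (a, -b). *)
have on_line (t : int) : b * (u + a * t) + a * (u * r + v * m - b * t) = m.
  have -> : b = q * m - a * r by lia.
  transitivity ((u * q + v * a) * m); first ring.
  by rewrite bez mul1r.
have in_lattice (t : int) : u * r + v * m - b * t =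
    (u + a * t) * r - (t * q - v) * m.
  have -> : b = q * m - a * r by lia.
  ring.
have ab : a * b <= m.
  have : a * b <= s%:Z * s%:Z by apply: ler_pM => //; apply: ltW.
  by move: s2; rewrite -mulnn; lia.
case: (leP a b) => cab.
  (* The range is 1 <= y <= b rather than 0 <= y < b: y >= 1 gives b x < m, hence x < m even when b
     = 1, and y <= b gives x >= 0 because a b <= m. *)
  pose t := ((u * r + v * m - 1) %/ b)%Z.
  have y1 : 1 <= u * r + v * m - b * t <= b.
    have := divz_eq (u * r + v * m - 1) b; rewrite -/t.
    have := modz_ge0 (u * r + v * m - 1) (lt0r_neq0 b0).
    have := ltz_pmod (u * r + v * m - 1) b0.
    lia.
  exists (u + a * t), (u * r + v * m - b * t), (t * q - v).
  move: (on_line t) (in_lattice t) y1.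
  move: (u + a * t) (u * r + v * m - b * t) (t * q - v).
  move=> x y p l1 l2 /andP[y1 y2].
  have ay : a * y <= a * b by rewrite ler_pM2l.
  have ay1 : a <= a * y by rewrite ler_peMr // ltW.
  have x0 : 0 <= x by rewrite -(pmulr_rge0 _ b0); lia.
  (* Otherwise y would be a positive multiple of m, but y <= b <= s < m. *)
  have xn0 : x <> 0.
    move=> x00; move: l2; rewrite x00 mul0r sub0r => yE.
    have : 0 < - p by nia.
    nia.
  have xb : x <= b * x by rewrite ler_peMl //; lia.
  have bb : b * y <= b * s by rewrite ler_pM2l //; lia.
  split=> //; lia.
(* Now 1 <= x <= a: this keeps x positive, and a b <= m gives y >= 0. *)
pose t := - ((u - 1) %/ a)%Z.
have x1 : 1 <= u + a * t <= a.
  have := divz_eq (u - 1) a; rewrite /t.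
  have := modz_ge0 (u - 1) (lt0r_neq0 a0).
  have := ltz_pmod (u - 1) a0.
  lia.
exists (u + a * t), (u * r + v * m - b * t), (t * q - v).
move: (on_line t) (in_lattice t) x1.
move: (u + a * t) (u * r + v * m - b * t) (t * q - v).
move=> x y p l1 l2 /andP[x1 x2].
have bx : b * x <= a * b by rewrite mulrC ler_pM2r.
have y0 : 0 <= y by rewrite -(pmulr_rge0 _ a0); lia.
have bx0 : 0 < b * x by rewrite mulr_gt0 //; lia.
have aa : a * x <= a * s by rewrite ler_pM2l //; lia.
split=> //; lia.
Qed.

Lemma H_approx (R : realType) (r : int) (m s : nat) : (1 < m)%N ->
  (s ^ 2 <= m < s.+1 ^ 2)%N ->
  H R r m <= s.*2%:R / m%:R \/
  exists2 k : nat, (0 < k)%N & k%:R^-1 <= H R r m <= k%:R^-1 + s%:R / m%:R.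
Proof.
move=> m1 /andP[sm ms]; have lt_sm : (s < m)%N by nia.
have [a [e [q [/andP[a0 As] /andP[e0 es] E]]]] := thue r m s lt_sm ms.
have mR : 0 < m%:R :> R by rewrite ltr0n; lia.
case: (leP 0 e) => e00.
  left; apply: (le_trans (@H_le R r m a e q _ e00 _)); [lia|lia|].
  rewrite ler_pM2r ?invr_gt0 // -[s.*2%:R]/(s.*2%:Z%:~R) ler_int; lia.
right.
(* The vector is a (1, r) - q (0, m), so dividing by gcd(q, a) makes it primitive and provides the
   Bezout relation of [near_point]; both coordinates stay at most s in size. *)
have [u [v uv]] := Bezoutz q a.
have g0 : 0 < gcdz q a.
  by rewrite lt0r gcdz_eq0 negb_and (lt0r_neq0 a0) orbT.
have /dvdzP[q' q'E] := dvdz_gcdl q a.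
have /dvdzP[a' a'E] := dvdz_gcdr q a.
set g := gcdz q a in uv g0 q'E a'E.
pose b' := q' * m - a' * r.
have b'E : - e = b' * g.
  by rewrite /b' mulrBl mulrAC -q'E mulrAC -a'E; lia.
have uv' : u * q' + v * a' = 1.
  by apply: (mulIf (lt0r_neq0 g0)); rewrite mul1r mulrDl -!mulrA -q'E -a'E.
have a'0 : 0 < a' by rewrite -(pmulr_lgt0 _ g0) -a'E.
have b'0 : 0 < b' by rewrite -(pmulr_lgt0 _ g0) -b'E; lia.
have a's : a' <= a by rewrite a'E ler_peMr //; lia.
have b's : b' <= - e by rewrite b'E ler_peMr //; lia.
have vE : a' * r + b' = q' * m by rewrite /b'; lia.
have ha : 0 < a' <= s by lia.
have hb : 0 < b' <= s by lia.
have [x [y [p [hx hy yE hxy]]]] :=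
  near_point _ _ _ _ _ _ _ _ lt_sm sm ha hb vE uv'.
have [c cE] : exists c : nat, Num.max a' b' = c by exists `|Num.max a' b'|%N; lia.
have c0 : (0 < c)%N by lia.
have cR : 0 < c%:R :> R by rewrite ltr0n.
exists c => //; apply/andP; split.
  by apply: (@H_ge R r m a' b' c q') => //; lia.
apply: (le_trans (H_le R r m x y p hx hy yE)).
rewrite ler_pdivrMr // mulrDl divfK ?gt_eqF // -(ler_pM2l cR) mulrDr mulrA.
rewrite divff ?gt_eqF // mul1r.
rewrite -[c%:R]/(c%:Z%:~R) -[m%:R]/(m%:Z%:~R) -[s%:R]/(s%:Z%:~R).
by rewrite -!intrM -intrD ler_int -cE.
Qed.

Lemma H_ge0 (R : realType) (r : int) (m : nat) : (1 < m)%N -> 0 <= H R r m.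
Proof.
move=> m1; have [x [y [q [/andP[x0 _] y0 _ ->]]]] := H_attained R r m m1.
by rewrite divr_ge0 // ler0z addr_ge0 // ltW.
Qed.

(** * Distance to {0} U {1/k} *)

Lemma isolated_from_unit_fractions (R : realType) (x : R) :
  x != 0 -> (forall k : nat, (0 < k)%N -> k%:R^-1 != x) ->
  exists2 e : R, 0 < e
    & e <= `|x| /\ forall k : nat, (0 < k)%N -> e <= `|x - k%:R^-1|.
Proof.
move=> xn0 xk; case: (ltP x 0) => x0.
  exists `|x|; rewrite ?normr_gt0 //; split=> // k k0.
  have kR : 0 < k%:R^-1 :> R by rewrite invr_gt0 ltr0n.
  by rewrite !ltr0_norm; lra.
have {xn0}x0 : 0 < x by rewrite lt_neqAle eq_sym xn0.
(* With n = floor(1/x), the neighbours of x are 1/(n + 1) and 1/n; if n = 0 then x > 1, no 1/k lies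
   above x, and [e'] is a placeholder. *)
have /andP[n1 n2] := truncn_itv (ltW (etrans (invr_gt0 x) x0)).
set n := Num.trunc x^-1 in n1 n2.
have lo : n.+1%:R^-1 < x by rewrite invf_plt // posrE // ltr0n.
pose e' : R := if n == 0%N then 1 else n%:R^-1 - x.
have e'0 : 0 < e'.
  rewrite /e'; case: eqP => [//|/eqP n0].
  have n0R : 0 < n%:R :> R by rewrite ltr0n lt0n.
  rewrite subr_gt0 lt_neqAle eq_sym xk ?lt0n //=.
  by rewrite -(invrK x) lef_pV2 ?posrE ?invr_gt0.
exists (Num.min (x - n.+1%:R^-1) e'); first by rewrite lt_min subr_gt0 lo.
split=> [|k k0].
  by rewrite ge_min gtr0_norm // gerBl invr_ge0 ler0n.
rewrite ge_min; case: (ltnP n k) => nk.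
  have : k%:R^-1 <= n.+1%:R^-1 :> R.
    by rewrite lef_pV2 ?posrE ?ltr0n // ler_nat.
  move=> kn; rewrite ger0_norm ?lerD2l ?lerN2 ?kn //.
  by rewrite subr_ge0 (le_trans kn) // ltW.
have n0 : (0 < n)%N by lia.
have : n%:R^-1 <= k%:R^-1 :> R by rewrite lef_pV2 ?posrE ?ltr0n // ler_nat.
move: e'0; rewrite /e' gtn_eqF // => e'0 kn.
by apply/orP; right; rewrite ler0_norm; lra.
Qed.

(** For s = floor(sqrt m) >= N, s / m <= 1 / N, so both errors in [H_approx] are at most 2 / N. *)
Lemma H_near_spectrum (R : realType) (r : int) (m N : nat) :
  (0 < N)%N -> (1 < m)%N -> (N ^ 2 <= m)%N ->
  `|H R r m| <= 2 / N%:R \/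
  exists2 k : nat, (0 < k)%N & `|H R r m - k%:R^-1| <= 2 / N%:R.
Proof.
move=> N0 m1 Nm.
have [s sm] : exists s, (s ^ 2 <= m < s.+1 ^ 2)%N.
  have ex : exists s, (s ^ 2 <= m)%N by exists N.
  have ub s : (s ^ 2 <= m)%N -> (s <= m)%N by nia.
  case: (ex_maxnP ex ub) => s s1 s2; exists s; rewrite s1 ltnNge.
  by apply/negP => /s2; rewrite ltnn.
have Ns : (N <= s)%N by nia.
have s2 : s%:R / m%:R <= N%:R^-1 :> R.
  rewrite ler_pdivrMr ?ltr0n 1?ltnW // mulrC ler_pdivlMr ?ltr0n //.
  rewrite -natrM ler_nat; nia.
have N0R : 0 < N%:R^-1 :> R by rewrite invr_gt0 ltr0n.
case: (H_approx R r m s m1 sm) => [h|[k k0 /andP[h1 h2]]].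
  left; rewrite ger0_norm ?H_ge0 //; apply: le_trans h _.
  by rewrite -mul2n natrM -mulrA ler_pM2l.
right; exists k => //; rewrite ger0_norm ?subr_ge0 //; lra.
Qed.

(** * The limits that occur, and the equality of the two sets *)

Lemma zero_in_Spec (R : realType) : Spec R 0.
Proof.
exists (fun i => i.+2), (fun=> 1); split=> //.
- apply/cvgnyPge => A; near=> i.
  have : (A <= i)%N by near: i; exact: nbhs_infty_ge.
  by lia.
- by move=> i; rewrite coprimezE coprime1n.
have h2 : (2 * harmonic i : R) @[i --> \oo] --> (0 : R).
  by rewrite -[X in _ --> X](mulr0 2); apply: cvgMr; exact: cvg_harmonic.
apply: (@squeeze_cvgr _ _ _ _ (fun=> 0) _ _ _ _ (cvg_cst _) h2).
near=> i; rewrite H_ge0 //=.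
(* The point (1, 1). *)
apply: (le_trans (@H_le R 1 i.+2 1 1 0 _ _ _)) => //.
rewrite ler_pM2l ?ltr0n // /harmonic lef_pV2 ?posrE ?ltr0n // ler_nat //.
Unshelve. all: by end_near.
Qed.

Lemma unit_fraction_in_Spec (R : realType) (k : nat) :
  (0 < k)%N -> Spec R k%:R^-1.
Proof.
move=> k0.
exists (fun i => (k * i.+1).+1), (fun=> - k%:Z); split=> //.
- apply/cvgnyPge => A; near=> i.
  have : (A <= i)%N by near: i; exact: nbhs_infty_ge.
  by nia.
- move=> i; rewrite coprimezE /= abszN.
  by rewrite -addn1 mulnC /coprime gcdnMDl gcdn1.
have h2 : (k%:R^-1 + harmonic i : R) @[i --> \oo] --> (k%:R^-1 : R).
  rewrite -[X in _ --> X]addr0; apply: cvgD; first exact: cvg_cst.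
  exact: cvg_harmonic.
apply: (@squeeze_cvgr _ _ _ _ (fun=> k%:R^-1) _ _ _ _ (cvg_cst _) h2).
near=> i; apply/andP; split.
  (* The lattice vector (1, -k). *)
  by apply: (@H_ge R _ _ 1 k k 0) => //; nia.
(* The point (i + 1, 1), as - k (i + 1) + m = 1. *)
apply: (le_trans (@H_le R _ _ i.+1 1 (-1) _ _ _)); [nia|by []|nia|].
have kR : 0 < k%:R :> R by rewrite ltr0n.
have iR : 0 < i.+1%:R :> R by rewrite ltr0n.
rewrite /harmonic intrD -![(Posz _)%:~R]/(_%:R) ler_pdivrMr ?ltr0n //=.
rewrite -[(k * _).+1]addn1 natrD natrM.
move: iR; move: (i.+1%:R : R) => x x0.
have xi : 0 < x^-1 by rewrite invr_gt0.
have ki : 0 < k%:R^-1 :> R by rewrite invr_gt0.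
have xx : x * x^-1 = 1 by rewrite divff // gt_eqF.
have kk : k%:R * k%:R^-1 = 1 :> R by rewrite divff // gt_eqF.
have k1 : 1 <= k%:R :> R by rewrite ler1n.
have -> : (k%:R^-1 + x^-1) * (k%:R * x + 1)
   = (k%:R * k%:R^-1) * x + k%:R^-1 + k%:R * (x * x^-1) + x^-1 by ring.
rewrite xx kk; lra.
Unshelve. all: by end_near.
Qed.

Theorem theorem1p1 (R : realType) :
  Spec R = [set 0] `|` [set k%:R^-1 | k in [set k : nat | (0 < k)%N]].
Proof.
apply/seteqP; split=> [x|x [->|[k k0 <-]]]; last 2 first.
- exact: zero_in_Spec.
- exact: unit_fraction_in_Spec.
move=> [m [r [_ m_oo _ Hx]]].
have [->|x0] := eqVneq x 0; first by left.
have [[k k0 kx]|nk] := pselect (exists2 k : nat, (0 < k)%N & k%:R^-1 = x).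
  by right; exists k.
have [k k0|e e0 [ex ek]] := isolated_from_unit_fractions R x x0.
  by apply/eqP => kx; apply: nk; exists k.
(* For a suitable index, [H] is within e / 4 of x and within 2 / N < e / 2 of 0 or some 1/k, which
   puts x closer than e to that point. *)
have e40 : 0 < e / 4 by lra.
pose N := (Num.trunc (e / 4)^-1).+1.
have Ne : N%:R^-1 < e / 4.
  by rewrite invf_plt ?posrE ?ltr0n // truncnS_gt.
move/cvgrPdist_lt/(_ _ e40): Hx => Hx.
move/cvgnyPge/(_ (N ^ 2).+2): m_oo => m_oo.
have [i [mi Hi]] := filter_ex (filterI m_oo Hx).
have m1 : (1 < m i)%N by lia.
have Nm : (N ^ 2 <= m i)%N by lia.
case: (H_near_spectrum R (r i) (m i) N isT m1 Nm) => [h|[k k0 h]].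
  have := ler_distD (H R (r i) (m i)) x 0; rewrite !subr0; lra.
have := ler_distD (H R (r i) (m i)) x k%:R^-1; have := ek k k0; lra.
Qed.
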